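(* For every $X\in 2^{\omega}$ the following are equivalent: (a) $X$ is granularly random; (b) for every $Y\in 2^{\omega}$ and every weak truth-table reduction $(\Phi,h)$ with $\Phi^Y=X$, there is a constant $c$ such that for all $n$ the $Y$-use of this reduction in the computation of $X\restriction_n$ is at least $n-c$.
   Context: $X\restriction_n$ is the first $n$ bits of $X$; $K$ is prefix-free Kolmogorov complexity. A weak truth-table reduction is a Turing functional $\Phi$ together with a computable function $h$ such that for every oracle $Z$ and every $i$ with $\Phi^Z(i)$ defined, the computation queries only oracle positions $\leq h(i)$; $h$ is the oracle-use of the reduction, and the use for computing $X\restriction_n$ is one more than $\max_{i<n}h(i)$. A Martin-L\''of test is a uniformly c.e. sequence $(V_i)$ of sets of binary strings with $\mu(V_i)\leq 2^{-i}$ ($\mu$ = Lebesgue measure of the reals with a prefix in the set). It is computably granular if there is a computable increasing $g$ such that every string in $V_i$ has length at most $g(i)$. $X$ is granularly random if there is no computably granular Martin-L\''of test $(V_i)$ such that $X$ has a prefix in every $V_i$ (equivalently, there is no computable $g$ with $K(X\restriction_{g(i)})\leq g(i)-i$ for all $i$). *)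

(* Defs.v *)
From mathcomp Require Import all_boot all_order all_algebra.
From mathcomp Require Import all_classical all_reals all_analysis.
From Stdlib Require Cantor.

Set Implicit Arguments.
Unset Strict Implicit.
Unset Printing Implicit Defensive.

Import Order.TTheory GRing.Theory Num.Theory.

Local Open Scope nat_scope.

Definition cpair (x y : nat) : nat := Cantor.to_nat (x, y).

(* Kleene's partial recursive functionals, in the unary presentation where
   several arguments are packed into one by the Cantor pairing function.
   [PRec f g] is primitive recursion, [PMin f] unbounded search, and [POracle]
   asks the oracle for the bit at the position given by the argument. *)
Inductive prog : Type :=
  | PZero
  | PSucc
  | PFst
  | PSnd
  | POracle
  | PPair of prog & prog
  | PComp of prog & prog
  | PRec of prog & prog
  | PMin of prog.

(* [runs Z p x y q]: with oracle [Z], the program [p] halts on input [x] with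
   output [y], and [q] lists all the oracle positions queried on the way.
   [PMin f] on [cpair a n] looks for the least [m >= n] with [f (cpair a m) = 0],
   all the values of [f] met before being defined. *)
Inductive runs (Z : nat -> bool) : prog -> nat -> nat -> seq nat -> Prop :=
  | runs_zero x : runs Z PZero x 0 [::]
  | runs_succ x : runs Z PSucc x x.+1 [::]
  | runs_fst x y : runs Z PFst (cpair x y) x [::]
  | runs_snd x y : runs Z PSnd (cpair x y) y [::]
  | runs_oracle x : runs Z POracle x (Z x) [:: x]
  | runs_pair f g x u v q r :
      runs Z f x u q -> runs Z g x v r ->
      runs Z (PPair f g) x (cpair u v) (q ++ r)
  | runs_comp f g x u v q r :
      runs Z g x u q -> runs Z f u v r ->
      runs Z (PComp f g) x v (q ++ r)
  | runs_rec0 f g a y q :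
      runs Z f a y q ->
      runs Z (PRec f g) (cpair a 0) y q
  | runs_recS f g a n u y q r :
      runs Z (PRec f g) (cpair a n) u q ->
      runs Z g (cpair a (cpair n u)) y r ->
      runs Z (PRec f g) (cpair a n.+1) y (q ++ r)
  | runs_min0 f a n q :
      runs Z f (cpair a n) 0 q ->
      runs Z (PMin f) (cpair a n) n q
  | runs_minS f a n u y q r :
      runs Z f (cpair a n) u.+1 q ->
      runs Z (PMin f) (cpair a n.+1) y r ->
      runs Z (PMin f) (cpair a n) y (q ++ r).

Definition no_oracle : nat -> bool := fun=> false.

Definition computable (f : nat -> nat) : Prop :=
  exists p, forall x, exists q, runs no_oracle p x (f x) q.

(* Bijective base-2 numbering of the binary strings. *)
Definition str_code (s : seq bool) : nat :=
  foldr (fun (b : bool) m => (b + m.*2).+1) 0 s.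

Definition uniformly_ce (V : nat -> set (seq bool)) : Prop :=
  exists p, forall i s,
    V i s <-> exists y q, runs no_oracle p (cpair i (str_code s)) y q.

Definition restr (X : nat -> bool) (n : nat) : seq bool := mkseq X n.

Section Randomness.
Local Open Scope classical_set_scope.
Local Open Scope ring_scope.

(* The reals of the unit interval whose binary expansion extends [s]. *)
Definition cylinder (R : realType) (s : seq bool) : set R :=
  let a := \sum_(k < size s) (nth false s k)%:R / 2 ^+ k.+1 in
  `[a, a + (2 ^+ size s)^-1[.

Definition str_measure (R : realType) (A : set (seq bool)) : \bar R :=
  lebesgue_measure (\bigcup_(s in A) @cylinder R s).

Definition martin_lof_test (R : realType) (V : nat -> set (seq bool)) : Prop :=
  uniformly_ce V /\
  forall i, (str_measure R (V i) <= ((2 ^+ i)^-1)%:E)%E.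

End Randomness.

Definition computably_granular (V : nat -> set (seq bool)) : Prop :=
  exists g : nat -> nat,
    [/\ computable g, {homo g : i j / i < j}
      & forall i s, V i s -> size s <= g i].

Definition granularly_random (R : realType) (X : nat -> bool) : Prop :=
  ~ exists V : nat -> set (seq bool),
      [/\ martin_lof_test R V, computably_granular V
        & forall i, exists n, V i (restr X n)].

Definition wtt_reduction (Phi : prog) (h : nat -> nat) : Prop :=
  computable h /\
  forall Z i y q, runs Z Phi i y q -> forall k : nat, k \in q -> k <= h i.

Definition maps_to (Phi : prog) (Y X : nat -> bool) : Prop :=
  forall i, exists q, runs Y Phi i (X i) q.

(* The oracle-use in the computation of the first [n] bits. *)
Definition use (h : nat -> nat) (n : nat) : nat := (\max_(i < n) h i).+1.

(* Main.v *)
Require Import Defs.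
From mathcomp Require Import all_boot all_order all_algebra.
From mathcomp Require Import all_classical all_reals all_analysis.
From mathcomp Require Import zify lra.
From Stdlib Require Cantor.

(* If the use for [n] bits falls below [n - i] for every [i] (at a length [n i]
   found effectively), the strings of length [n i] computed from the oracles of
   length [use h (n i)] form a computably granular test that captures [X].

   Conversely, let a test with bound [g] capture [X]. At most [2 ^ (g i - i)]
   strings of length [g i] have a prefix in the [i]-th component, so the first
   [g i] bits of [X] can be decoded from the [g i - i] binary digits of their rank
   in an enumeration of these strings. The oracle [Y] is the concatenation of such
   codes for levels that grow so fast that the bits saved in one block outnumber
   all the positions of the previous blocks. *)

Set Implicit Arguments.
Unset Strict Implicit.
Unset Printing Implicit Defensive.

Local Open Scope nat_scope.

(** * Recursive functions *)

(** The use bound of a reduction must hold for every oracle, not only for [Y]. The decoder therefore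
    determines from the argument alone which block to read, reads all of it, and does the rest with
    oracle-free programs. On an oracle whose block is no code its search diverges, which is harmless
    because the bound concerns halting runs only.

    Each block describes an initial segment of [X] from bit 0 on, not just the bits that earlier
    blocks leave open: membership in a test compresses whole initial segments only.

    In the other direction the obstacle is that [Phi] may diverge on the finite oracles that are
    tried. Enumerating the computed strings takes a recursive step-bounded simulation that never
    revokes an answer; the same simulation enumerates the given test when codes are decoded. Finite
    oracles and strings of known length are both handled as numbers read in binary, so that all
    searches range over numbers. *)

Definition cfst (z : nat) : nat := (Cantor.of_nat z).1.
Definition csnd (z : nat) : nat := (Cantor.of_nat z).2.

Lemma cfst_cpair x y : cfst (cpair x y) = x.
Proof. by rewrite /cfst /cpair Cantor.cancel_of_to. Qed.

Lemma csnd_cpair x y : csnd (cpair x y) = y.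
Proof. by rewrite /csnd /cpair Cantor.cancel_of_to. Qed.

Lemma cpair_proj z : cpair (cfst z) (csnd z) = z.
Proof. by rewrite /cfst /csnd /cpair -surjective_pairing Cantor.cancel_to_of. Qed.

Lemma cpair_inj x y x' y' : cpair x y = cpair x' y' -> x = x' /\ y = y'.
Proof.
move=> e; split; first by rewrite -(cfst_cpair x y) e cfst_cpair.
by rewrite -(csnd_cpair x y) e csnd_cpair.
Qed.

Definition cpairE := (cfst_cpair, csnd_cpair).

Opaque cpair.

(** The inputs [cpair a n] in the rules of [runs] are not constructor patterns. Phrasing inversion
    through [cfst] and [csnd] makes it applicable to any input. *)
Lemma runsE Z p x y q : runs Z p x y q ->
  match p with
  | PZero => y = 0 /\ q = [::]
  | PSucc => y = x.+1 /\ q = [::]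
  | PFst => y = cfst x /\ q = [::]
  | PSnd => y = csnd x /\ q = [::]
  | POracle => y = Z x /\ q = [:: x]
  | PPair f g => exists u v q1 q2,
      [/\ runs Z f x u q1, runs Z g x v q2, y = cpair u v & q = q1 ++ q2]
  | PComp f g => exists u q1 q2,
      [/\ runs Z g x u q1, runs Z f u y q2 & q = q1 ++ q2]
  | PRec f g =>
      match csnd x with
      | 0 => runs Z f (cfst x) y q
      | n.+1 => exists u q1 q2, [/\ runs Z (PRec f g) (cpair (cfst x) n) u q1,
          runs Z g (cpair (cfst x) (cpair n u)) y q2 & q = q1 ++ q2]
      end
  | PMin f =>
      (y = csnd x /\ runs Z f x 0 q) \/
      exists u q1 q2, [/\ runs Z f x u.+1 q1,
        runs Z (PMin f) (cpair (cfst x) (csnd x).+1) y q2 & q = q1 ++ q2]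
  end.
Proof.
case=> {p x y q} //.
- by move=> x y; rewrite cpairE.
- by move=> x y; rewrite cpairE.
- by move=> f g x u v q r Hf Hg; exists u, v, q, r.
- by move=> f g x u v q r Hf Hg; exists u, q, r.
- by move=> f g a y q H; rewrite !cpairE.
- by move=> f g a n u y q r H1 H2; rewrite !cpairE; exists u, q, r.
- by move=> f a n q H; rewrite !cpairE; left.
- by move=> f a n u y q r H1 H2; rewrite !cpairE; right; exists u, q, r.
Qed.

Lemma runs_det Z p x y q y' q' :
  runs Z p x y q -> runs Z p x y' q' -> y = y' /\ q = q'.
Proof.
move=> H; elim: H y' q' => {p x y q}
  [x|x|x y|x y|x|f g x u v q r _ IHf _ IHg|f g x u v q r _ IHg _ IHf
  |f g a y q _ IH|f g a n u y q r _ IH1 _ IH2|f a n q _ IH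
  |f a n u y q r _ IH1 _ IH2] y' q' /runsE; rewrite ?cpairE.
- by case=> -> ->.
- by case=> -> ->.
- by case=> -> ->.
- by case=> -> ->.
- by case=> -> ->.
- case=> u' [v' [q1 [q2 [/IHf [<- <-] /IHg [<- <-] -> ->]]]]; done.
- by case=> u' [q1 [q2 [/IHg [<- <-] /IHf [<- <-] ->]]].
- by move/IH.
- by case=> u' [q1 [q2 [/IH1 [<- <-] /IH2 [<- <-] ->]]].
- case=> [[-> /IH [_ <-]] //|[u' [q1 [q2 [/IH []]]]]]; done.
- case=> [[-> /IH1 []] //|[u' [q1 [q2 [/IH1 [_ <-] /IH2 [<- <-] ->]]]]]; done.
Qed.

(** The use principle; it allows [Y] to be replaced by a finite part of itself. *)
Lemma runs_agree Z Z' p x y q :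
  runs Z p x y q -> {in q, Z =1 Z'} -> runs Z' p x y q.
Proof.
have sub (A B : seq nat) : {in A ++ B, Z =1 Z'} ->
    {in A, Z =1 Z'} /\ {in B, Z =1 Z'}.
  by move=> H; split=> k kA; apply: H; rewrite mem_cat kA ?orbT.
elim=> {p x y q}
  [x|x|x y|x y|x|f g x u v q r _ IHf _ IHg|f g x u v q r _ IHg _ IHf
  |f g a y q _ IH|f g a n u y q r _ IH1 _ IH2|f a n q _ IH
  |f a n u y q r _ IH1 _ IH2] H; try (by constructor);
  try (by constructor; apply: IH); last first.
- by have [? ?] := sub _ _ H; apply: runs_minS (IH1 _) (IH2 _).
- by have [? ?] := sub _ _ H; apply: runs_recS (IH1 _) (IH2 _).
- by have [? ?] := sub _ _ H; apply: runs_comp (IHg _) (IHf _).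
- by have [? ?] := sub _ _ H; apply: runs_pair (IHf _) (IHg _).
- by rewrite H ?mem_head //; constructor.
Qed.

(** A syntactic condition, so that the absence of queries is known for partial programs too, in
    particular for unbounded searches inside a reduction. *)
Fixpoint oracle_free (p : prog) : bool :=
  match p with
  | POracle => false
  | PPair f g | PComp f g | PRec f g => oracle_free f && oracle_free g
  | PMin f => oracle_free f
  | _ => true
  end.

Lemma oracle_free_queries Z p x y q :
  oracle_free p -> runs Z p x y q -> q = [::].
Proof.
move=> + H; elim: H => {p x y q} //=
  [f g x u v q r _ IHf _ IHg|f g x u v q r _ IHg _ IHf
  |f g a y q _ IH|f g a n u y q r _ IH1 _ IH2
  |f a n u y q r _ IH1 _ IH2].
- by case/andP=> /IHf -> /IHg ->.
- by case/andP=> /IHf -> /IHg ->.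
- by case/andP=> /IH.
- by case/andP=> H1 H2; rewrite IH1 ?H1 // IH2.
- by move=> H; rewrite IH1 // IH2.
Qed.

(** [no_oracle] answers 0 to every query, so [PZero] in place of [POracle] keeps all values and
    makes them independent of the oracle. *)
Fixpoint strip_oracle (p : prog) : prog :=
  match p with
  | POracle => PZero
  | PPair f g => PPair (strip_oracle f) (strip_oracle g)
  | PComp f g => PComp (strip_oracle f) (strip_oracle g)
  | PRec f g => PRec (strip_oracle f) (strip_oracle g)
  | PMin f => PMin (strip_oracle f)
  | _ => p
  end.

Lemma strip_oracle_free p : oracle_free (strip_oracle p).
Proof. by elim: p => //= f -> g ->. Qed.

Lemma runs_strip_oracle Z p x y q :
  runs no_oracle p x y q -> runs Z (strip_oracle p) x y [::].
Proof.
elim=> {p x y q} /=; try (by constructor).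
- move=> f g x u v q r _ H1 _ H2; exact: (runs_pair H1 H2).
- move=> f g x u v q r _ H1 _ H2; exact: (runs_comp H1 H2).
- move=> f g a n u y q r _ H1 _ H2; exact: (runs_recS H1 H2).
- move=> f a n u y q r _ H1 _ H2; exact: (runs_minS H1 H2).
Qed.

Lemma runs_PMinP Z f a n y : (exists q, runs Z (PMin f) (cpair a n) y q) <->
  [/\ n <= y, exists q, runs Z f (cpair a y) 0 q
    & forall m, n <= m < y -> exists u q, runs Z f (cpair a m) u.+1 q].
Proof.
split=> [[q H]|[]].
  have aux P x y' q' : runs Z P x y' q' ->
      forall n, P = PMin f -> x = cpair a n ->
      [/\ n <= y', exists q, runs Z f (cpair a y') 0 q
      & forall m, n <= m < y' -> exists u q, runs Z f (cpair a m) u.+1 q].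
    elim=> // {P x y' q'}.
      move=> f' a' n' q' Hf _ n0 [<-] /cpair_inj[<- <-].
      split=> [//||m]; first by exists q'.
      by case/andP=> /leq_ltn_trans H1 /H1; rewrite ltnn.
    move=> f' a' n' u y' q' r Hf _ _ IH n0 ef /cpair_inj[ea <-].
    rewrite ea in IH; have [ny Hy Hm] := IH n'.+1 ef erefl.
    case: ef Hf => -> Hf; rewrite ea in Hf.
    split=> // [|m]; first exact: ltnW.
    rewrite leq_eqVlt; case: eqP => [<- _|_ /=]; last exact: Hm.
    by exists u, q'.
  exact: aux H _ erefl erefl.
move=> ny [q Hy]; rewrite -(subnKC ny) in Hy *.
clear ny; move: (y - n) Hy => d; elim: d n => [|d IH] n.
  by rewrite addn0 => H _; exists q; apply: runs_min0.
rewrite addnS -addSn => Hy Hm.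
have [|r Hr] := IH n.+1 Hy.
  by move=> m /andP[nm my]; apply: Hm; rewrite (ltnW nm).
have [|u [q' Hq]] := Hm n; first by rewrite leqnn addSn ltnS leq_addr.
by exists (q' ++ r); apply: runs_minS Hq Hr.
Qed.

(** Stronger in form than [computable]: the value is obtained from every oracle and without queries,
    so such a function can be a subroutine of a reduction without adding to its use. *)
Definition recursive (f : nat -> nat) : Prop :=
  exists2 p, oracle_free p & forall Z x, runs Z p x (f x) [::].

Definition recursive2 (f : nat -> nat -> nat) : Prop :=
  recursive (fun z => f (cfst z) (csnd z)).

Definition recursive3 (f : nat -> nat -> nat -> nat) : Prop :=
  recursive2 (fun x z => f x (cfst z) (csnd z)).

Lemma computable_recursive f : computable f -> recursive f.
Proof.
case=> p Hp; exists (strip_oracle p) => [|Z x]; first exact: strip_oracle_free.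
by have [q] := Hp x; apply: runs_strip_oracle.
Qed.

Lemma recursive_computable f : recursive f -> computable f.
Proof. by case=> p _ Hp; exists p => x; exists [::]. Qed.

Lemma recursive_ext f g : f =1 g -> recursive f -> recursive g.
Proof. by move=> fg [p fp Hp]; exists p => // Z x; rewrite -fg. Qed.

Lemma recursive_comp f g :
  recursive f -> recursive g -> recursive (fun x => f (g x)).
Proof.
case=> [p fp Hp] [r fr Hr]; exists (PComp p r) => /= [|Z x].
  by rewrite fp fr.
exact: (runs_comp (Hr Z x) (Hp Z (g x))).
Qed.

Lemma recursive_pair f g :
  recursive f -> recursive g -> recursive (fun x => cpair (f x) (g x)).
Proof.
case=> [p fp Hp] [r fr Hr]; exists (PPair p r) => /= [|Z x].
  by rewrite fp fr.
exact: (runs_pair (Hp Z x) (Hr Z x)).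
Qed.

Lemma recursive_cfst f : recursive f -> recursive (fun x => cfst (f x)).
Proof.
apply: recursive_comp; exists PFst => // Z x.
by rewrite -[x in runs _ _ x _ _]cpair_proj; constructor.
Qed.

Lemma recursive_csnd f : recursive f -> recursive (fun x => csnd (f x)).
Proof.
apply: recursive_comp; exists PSnd => // Z x.
by rewrite -[x in runs _ _ x _ _]cpair_proj; constructor.
Qed.

Lemma recursive_S f : recursive f -> recursive (fun x => (f x).+1).
Proof. by apply: recursive_comp; exists PSucc => // Z x; constructor. Qed.

Lemma recursive_id : recursive (fun x => x).
Proof.
apply: recursive_ext cpair_proj _.
exists (PPair PFst PSnd) => // Z x; apply: (runs_pair (q := [::]) (r := [::])).
  by rewrite -[x in runs _ _ x _ _]cpair_proj; constructor.
by rewrite -[x in runs _ _ x _ _]cpair_proj; constructor.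
Qed.

Lemma recursive_const c : recursive (fun=> c).
Proof.
elim: c => [|c IH]; first by exists PZero => // Z x; constructor.
exact: recursive_S.
Qed.

Lemma recursive_app2 f g h : recursive2 f -> recursive g -> recursive h ->
  recursive (fun x => f (g x) (h x)).
Proof.
move=> Hf Hg Hh; have := recursive_comp Hf (recursive_pair Hg Hh).
by apply: recursive_ext => x; rewrite !cpairE.
Qed.

Lemma recursive_app3 f g h k :
  recursive3 f -> recursive g -> recursive h -> recursive k ->
  recursive (fun x => f (g x) (h x) (k x)).
Proof.
move=> Hf Hg Hh Hk.
have := @recursive_app2 (fun x z => f x (cfst z) (csnd z)) _ _ Hf Hg
    (recursive_pair Hh Hk).
by apply: recursive_ext => x; rewrite !cpairE.
Qed.

(** [iteri] is [PRec] with the whole input [x] kept as parameter. The arithmetic below is reduced to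
    this one scheme. *)
Lemma recursive_iteri n f g : recursive n -> recursive f -> recursive3 g ->
  recursive (fun x => iteri (n x) (g x) (f x)).
Proof.
move=> Hn [p fp Hp] [r fr Hr].
have Hrec : recursive2 (fun n x => iteri n (g x) (f x)).
  have : recursive (fun z => iteri (csnd z) (g (cfst z)) (f (cfst z))).
    exists (PRec p r) => [|Z x]; first by rewrite /= fp fr.
    rewrite -[x in runs _ _ x _ _]cpair_proj.
    elim: (csnd x) => [|m IH] /=; first by constructor.
    apply: (runs_recS (q := [::]) (r := [::]) IH).
    by have := Hr Z (cpair (cfst x) (cpair m (iteri m (g (cfst x)) (f (cfst x)))));
      rewrite !cpairE.
  move=> H; have Hsw : recursive (fun z => cpair (csnd z) (cfst z)).
    by apply: recursive_pair; [apply: recursive_csnd|apply: recursive_cfst];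
      apply: recursive_id.
  apply: recursive_ext (recursive_comp H Hsw) => z.
  by rewrite !cpairE.
exact: (recursive_app2 Hrec Hn recursive_id).
Qed.

(** * Arithmetic and bounded operations *)

Ltac rec_step :=
  lazymatch goal with
  | |- recursive2 _ => unfold recursive2; cbv beta
  | |- recursive3 _ => unfold recursive3, recursive2; cbv beta
  | |- recursive (fun x => x) => exact recursive_id
  | |- recursive (fun _ => ?c) => exact (recursive_const c)
  | |- recursive (fun x => S (@?f x)) => apply: (@recursive_S f)
  | |- recursive (fun x => cfst (@?f x)) => apply: (@recursive_cfst f)
  | |- recursive (fun x => csnd (@?f x)) => apply: (@recursive_csnd f)
  | |- recursive (fun x => cpair (@?f x) (@?g x)) =>
      apply: (@recursive_pair f g)
  | |- recursive (fun x => iteri (@?n x) (@?g x) (@?f x)) =>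
      apply: (@recursive_iteri n f g)
  | H : recursive ?f |- recursive ?f => exact H
  | H : recursive ?f |- recursive (fun x => ?f (@?g x)) =>
      apply: (@recursive_comp f g H)
  | H : recursive2 ?f |- recursive (fun x => ?f (@?g x) (@?h x)) =>
      apply: (@recursive_app2 f g h H)
  | H : recursive2 (fun a b => nat_of_bool (?P a b))
    |- recursive (fun x => nat_of_bool (?P (@?g x) (@?h x))) =>
      refine (@recursive_app2 _ g h H _ _); cbv beta
  | H : recursive3 (fun a b c => nat_of_bool (?P a b c))
    |- recursive (fun x => nat_of_bool (?P (@?g x) (@?h x) (@?k x))) =>
      refine (@recursive_app3 _ g h k H _ _ _); cbv beta
  | H : recursive3 ?f |- recursive (fun x => ?f (@?g x) (@?h x) (@?k x)) =>
      apply: (@recursive_app3 f g h k H)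
  end.
Ltac rec_auto := repeat rec_step.

Lemma recursive_addn f g :
  recursive f -> recursive g -> recursive (fun x => f x + g x).
Proof.
move=> Hf Hg; have : recursive (fun x => iteri (f x) (fun _ u => u.+1) (g x)).
  by rec_auto.
by apply: recursive_ext => x; elim: (f x) => //= n ->.
Qed.

Lemma recursive_pred f : recursive f -> recursive (fun x => (f x).-1).
Proof.
move=> Hf; have : recursive (fun x => iteri (f x) (fun j _ => j) 0).
  by rec_auto.
by apply: recursive_ext => x; case: (f x).
Qed.

Lemma recursive_muln f g :
  recursive f -> recursive g -> recursive (fun x => f x * g x).
Proof.
move=> Hf Hg; have : recursive (fun x => iteri (f x) (fun _ u => u + g x) 0).
  apply: recursive_iteri; rec_auto.
  by rewrite /recursive3 /recursive2; apply: recursive_addn; rec_auto.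
by apply: recursive_ext => x; elim: (f x) => //= n ->; rewrite mulSn addnC.
Qed.

Lemma recursive_subn f g :
  recursive f -> recursive g -> recursive (fun x => f x - g x).
Proof.
move=> Hf Hg; have : recursive (fun x => iteri (g x) (fun _ u => u.-1) (f x)).
  apply: recursive_iteri; rec_auto.
  by rewrite /recursive3 /recursive2; apply: recursive_pred; rec_auto.
by apply: recursive_ext => x; elim: (g x) => /= [|n ->]; rewrite ?subn0 ?subnS.
Qed.

Lemma recursive_expn f g :
  recursive f -> recursive g -> recursive (fun x => f x ^ g x).
Proof.
move=> Hf Hg; have : recursive (fun x => iteri (g x) (fun _ u => f x * u) 1).
  apply: recursive_iteri; rec_auto.
  by rewrite /recursive3 /recursive2; apply: recursive_muln; rec_auto.
by apply: recursive_ext => x; elim: (g x) => //= n ->; rewrite expnS.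
Qed.

Lemma recursive_leq f g : recursive f -> recursive g ->
  recursive (fun x => nat_of_bool (f x <= g x)).
Proof.
move=> Hf Hg; have : recursive (fun x => 1 - (f x - g x)).
  by apply: recursive_subn; rec_auto; apply: recursive_subn.
by apply: recursive_ext => x; rewrite /leq; case: (f x - g x).
Qed.

Lemma recursive_and (a b : nat -> bool) :
  recursive (fun x => nat_of_bool (a x)) ->
  recursive (fun x => nat_of_bool (b x)) ->
  recursive (fun x => nat_of_bool (a x && b x)).
Proof.
move=> Ha Hb; apply: recursive_ext (recursive_muln Ha Hb) => x.
by rewrite mulnb.
Qed.

Lemma recursive_not (a : nat -> bool) :
  recursive (fun x => nat_of_bool (a x)) ->
  recursive (fun x => nat_of_bool (~~ a x)).
Proof.
move=> Ha; apply: recursive_ext (recursive_subn (recursive_const 1) Ha) => x.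
by case: (a x).
Qed.

Lemma recursive_eqn f g : recursive f -> recursive g ->
  recursive (fun x => nat_of_bool (f x == g x)).
Proof.
move=> Hf Hg.
have := recursive_and (recursive_leq Hf Hg) (recursive_leq Hg Hf).
by apply: recursive_ext => x; rewrite eqn_leq.
Qed.

Lemma recursive_if (b : nat -> bool) f g :
  recursive (fun x => nat_of_bool (b x)) -> recursive f -> recursive g ->
  recursive (fun x => if b x then f x else g x).
Proof.
move=> Hb Hf Hg; have := recursive_addn (recursive_muln Hb Hf)
  (recursive_muln (recursive_not Hb) Hg).
by apply: recursive_ext => x; case: (b x); rewrite /= !mul1n ?addn0.
Qed.

Lemma recursive_odd f :
  recursive f -> recursive (fun x => nat_of_bool (odd (f x))).
Proof.
move=> Hf; have : recursive (fun x => iteri (f x) (fun _ u => 1 - u) 0).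
  apply: recursive_iteri; rec_auto.
  by rewrite /recursive3 /recursive2; apply: recursive_subn; rec_auto.
by apply: recursive_ext => x; elim: (f x) => //= n ->; case: (odd n).
Qed.

Lemma recursive_sum n F : recursive n -> recursive2 F ->
  recursive (fun x => \sum_(0 <= j < n x) F x j).
Proof.
move=> Hn HF.
have : recursive (fun x => iteri (n x) (fun j u => u + F x j) 0).
  apply: recursive_iteri; rec_auto.
  by rewrite /recursive3 /recursive2; apply: recursive_addn; rec_auto.
apply: recursive_ext => x; elim: (n x) => [|m /= ->]; first by rewrite big_geq.
by rewrite big_nat_recr.
Qed.

Lemma recursive_bigmax n F : recursive n -> recursive2 F ->
  recursive (fun x => \max_(0 <= j < n x) F x j).
Proof.
move=> Hn HF.
have : recursive (fun x => iteri (n x) (fun j u => u + (F x j - u)) 0).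
  apply: recursive_iteri; rec_auto.
  rewrite /recursive3 /recursive2.
  by apply: recursive_addn; rec_auto; apply: recursive_subn; rec_auto.
apply: recursive_ext => x; elim: (n x) => [|m /= ->]; first by rewrite big_geq.
by rewrite big_nat_recr //= -maxnE.
Qed.

Lemma recursive_all n (P : nat -> nat -> bool) : recursive n ->
  recursive2 (fun x j => nat_of_bool (P x j)) ->
  recursive (fun x => nat_of_bool (all (P x) (iota 0 (n x)))).
Proof.
move=> Hn HP.
have : recursive (fun x => iteri (n x) (fun j u => u * nat_of_bool (P x j)) 1).
  apply: recursive_iteri; rec_auto.
  rewrite /recursive3 /recursive2.
  by apply: recursive_muln; rec_auto.
apply: recursive_ext => x; elim: (n x) => // m IH.
by rewrite -[in RHS]addn1 iotaD all_cat -mulnb -IH /= andbT.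
Qed.

(** The quotient counts the positive multiples of [g x] up to [f x]. For [g x = 0] this count would
    be [f x], whence the factor [0 < g x]. *)
Lemma recursive_divn f g : recursive f -> recursive g ->
  recursive (fun x => f x %/ g x).
Proof.
move=> Hf Hg.
have : recursive
    (fun x => (0 < g x) * \sum_(0 <= j < f x) nat_of_bool (j.+1 * g x <= f x)).
  apply: recursive_muln; first by apply: recursive_leq; rec_auto.
  apply: (@recursive_sum _ (fun x j => nat_of_bool (j.+1 * g x <= f x))) => //.
  by rewrite /recursive2; apply: recursive_leq; [apply: recursive_muln|]; rec_auto.
apply: recursive_ext => x; case: (posnP (g x)) => [->|g0].
  by rewrite mul0n divn0.
rewrite mul1n; under eq_bigr => j _ do rewrite -leq_divRL //.
have := leq_div (f x) (g x); move: (f x %/ g x) => d.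
(* With [minn m d] in place of [d] the identity holds for every [m], so the induction can forget
   that [d <= m]. *)
move: (f x) => m /minn_idPr {2}<-.
elim: m => [|m IH]; first by rewrite big_geq ?min0n.
by rewrite big_nat_recr //= IH; case: leqP => ?; lia.
Qed.

Lemma recursive_modn f g : recursive f -> recursive g ->
  recursive (fun x => f x %% g x).
Proof.
move=> Hf Hg; have := recursive_subn Hf (recursive_muln (recursive_divn Hf Hg) Hg).
by apply: recursive_ext => x; rewrite {1}(divn_eq (f x) (g x)) addKn.
Qed.

Ltac rec_arith_step :=
  first [ rec_step |
  lazymatch goal with
  | |- recursive (fun x => @?f x + @?g x) => apply: (@recursive_addn f g)
  | |- recursive (fun x => (@?f x).-1) => apply: (@recursive_pred f)
  | |- recursive (fun x => @?f x * @?g x) => apply: (@recursive_muln f g)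
  | |- recursive (fun x => @?f x - @?g x) => apply: (@recursive_subn f g)
  | |- recursive (fun x => @?f x ^ @?g x) => apply: (@recursive_expn f g)
  | |- recursive (fun x => @?f x %/ @?g x) => apply: (@recursive_divn f g)
  | |- recursive (fun x => @?f x %% @?g x) => apply: (@recursive_modn f g)
  | |- recursive (fun x => nat_of_bool (@?f x <= @?g x)) =>
      apply: (@recursive_leq f g)
  | |- recursive (fun x => nat_of_bool (@?f x == @?g x)) =>
      apply: (@recursive_eqn f g)
  | |- recursive (fun x => nat_of_bool (@?f x && @?g x)) =>
      apply: (@recursive_and f g)
  | |- recursive (fun x => nat_of_bool (~~ @?f x)) =>
      apply: (@recursive_not f)
  | |- recursive (fun x => nat_of_bool (odd (@?f x))) =>
      apply: (@recursive_odd f)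
  | |- recursive (fun x => if _ then _ else _) => apply: recursive_if
  | |- recursive (fun x => \sum_(0 <= j < @?n x) @?F x j) =>
      apply: (@recursive_sum n F)
  | |- recursive (fun x => \max_(0 <= j < @?n x) @?F x j) =>
      apply: (@recursive_bigmax n F)
  | |- recursive (fun x => nat_of_bool (all (@?P x) (iota 0 (@?n x)))) =>
      apply: (@recursive_all n P)
  end ].
Ltac recursivity := repeat rec_arith_step.

(** [PMin] looks for a zero, hence the negated test in the proof. The equivalence also says that the
    program diverges when no [m] passes the test, which is what semidecision requires. *)
Lemma recursive_search (T : nat -> nat -> bool) :
  recursive2 (fun a m => nat_of_bool (T a m)) ->
  exists2 p, oracle_free p &
    forall Z a y q, runs Z p a y q <->
      [/\ q = [::], T a y & forall m, m < y -> ~~ T a m].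
Proof.
move=> HT.
have [f ff Hf] : recursive2 (fun a m => nat_of_bool (~~ T a m)).
  rewrite /recursive2; apply: recursive_not; exact: HT.
have [i fi Hi] : recursive (fun a => cpair a 0) by recursivity.
have Hv Z a m v : (exists q, runs Z f (cpair a m) v q) <->
    v = nat_of_bool (~~ T a m).
  have := Hf Z (cpair a m); rewrite !cpairE => H; split=> [[q]|->].
    by move=> H'; have [] := runs_det H' H.
  by exists [::].
have fm : oracle_free (PMin f) by [].
exists (PComp (PMin f) i) => [|Z a y q]; first by rewrite /= ff fi.
split.
  move=> /runsE[u [q1 [q2 [H1 H2 eq]]]]; rewrite {q}eq.
  have [eu eq] := runs_det H1 (Hi Z a); subst u q1; clear H1.
  have eq := oracle_free_queries fm H2; subst q2; split=> //.
    have [|_ /Hv] := (runs_PMinP Z f a 0 y).1; first by exists [::].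
    by case: (T a y).
  move=> m my; have [|_ _ H] := (runs_PMinP Z f a 0 y).1; first by exists [::].
  have [//|u [q Hu]] := H m.
  have : exists q, runs Z f (cpair a m) u.+1 q by exists q.
  by move/Hv; case: (T a m).
case=> -> Ty Tm {q}; apply: (runs_comp (q := [::]) (r := [::]) (Hi Z a)).
have [|q'] := (runs_PMinP Z f a 0 y).2.
  split=> // [|m /= /Tm Hm]; first by apply/Hv; rewrite Ty.
  by exists 0; apply/Hv; rewrite Hm.
by move=> H; have e := oracle_free_queries fm H; rewrite e in H.
Qed.

Lemma recursive_ex_min (T : nat -> nat -> bool) :
  recursive2 (fun a m => nat_of_bool (T a m)) ->
  (forall a, exists m, T a m) ->
  exists2 f, recursive f &
    forall a, T a (f a) /\ forall m, m < f a -> ~~ T a m.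
Proof.
move=> /recursive_search[p fp Hp] ex.
exists (fun a => ex_minn (ex a)); last first.
  move=> a; case: ex_minnP => m Tm Hm; split=> // k; rewrite ltnNge.
  by apply: contra => /Hm.
exists p => // Z a; apply/Hp; case: ex_minnP => m Tm Hm; split=> // k.
by rewrite ltnNge; apply: contra => /Hm.
Qed.

(** * Step-bounded simulation with a finite oracle *)

Lemma find_iota (P : pred nat) d n :
  d < n -> P d -> (forall j, j < d -> ~~ P j) -> find P (iota 0 n) = d.
Proof.
move=> dn Pd Pj; rewrite -(subnKC (ltnW dn)) iotaD find_cat.
have -> : has P (iota 0 d) = false.
  apply/hasPn => j; rewrite mem_iota /= add0n; exact: Pj.
by rewrite size_iota add0n -(subnSK dn) /= Pd addn0.
Qed.

Lemma recursive_find n (P : nat -> nat -> bool) : recursive n ->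
  recursive2 (fun x j => nat_of_bool (P x j)) ->
  recursive (fun x => find (P x) (iota 0 (n x))).
Proof.
(* After [j] rounds the accumulator is at most [j], and equal to [j] exactly when nothing has been
   found yet. *)
move=> Hn HP; have : recursive (fun x =>
    iteri (n x) (fun j d => if d.+1 <= j then d else if P x j then j else j.+1) 0).
  by recursivity.
apply: recursive_ext => x; elim: (n x) => // m IH.
rewrite -[in RHS]addn1 iotaD find_cat has_find size_iota /= IH.
by rewrite add0n; case: ifP => // _; case: ifP; rewrite ?addn0 ?addn1.
Qed.

(** Finite oracles are coded by numbers so that searches can range over them. Digits past the
    leading one are 0, which makes [bits w] a total oracle. *)
Definition bits (w j : nat) : bool := odd (w %/ 2 ^ j).

(* [S w x t] is [y.+1] if [p] is seen within [t] steps to output [y] on input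
   [x] with oracle [bits w], and [0] if it is not seen to halt. *)
Definition simulates (p : prog) (S : nat -> nat -> nat -> nat) : Prop :=
  [/\ recursive3 S,
      forall w x t y, S w x t = y.+1 -> exists q, runs (bits w) p x y q,
      forall w x y q, runs (bits w) p x y q -> exists t, S w x t = y.+1
    & forall w x y t t', t <= t' -> S w x t = y.+1 -> S w x t' = y.+1].

Lemma simulates_total p f : recursive2 f ->
  (forall w x, exists q, runs (bits w) p x (f w x) q) ->
  simulates p (fun w x _ => (f w x).+1).
Proof.
move=> Hf Hp; split.
- by recursivity.
- by move=> w x _ y [<-].
- move=> w x y q H; exists 0; have [r Hr] := Hp w x.
  by have [-> _] := runs_det H Hr.
- by [].
Qed.

Lemma simulates_pair f g Sf Sg : simulates f Sf -> simulates g Sg ->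
  simulates (PPair f g) (fun w x t =>
    if (Sf w x t == 0) then 0 else if Sg w x t == 0 then 0
    else (cpair (Sf w x t).-1 (Sg w x t).-1).+1).
Proof.
move=> [rf sf cf mf] [rg sg cg mg]; split.
- by recursivity.
- move=> w x t y; case ef: (Sf w x t) => [//|u]; case eg: (Sg w x t) => [//|v].
  move=> /= [<-]; have [q Hq] := sf _ _ _ _ ef; have [r Hr] := sg _ _ _ _ eg.
  by exists (q ++ r); constructor.
- move=> w x y q /runsE[u [v [q1 [q2 [/cf[t1 H1] /cg[t2 H2] -> _]]]]].
  exists (maxn t1 t2).
  by rewrite (mf _ _ _ _ _ (leq_maxl t1 t2) H1) (mg _ _ _ _ _ (leq_maxr t1 t2) H2).
- move=> w x y t t' tt'; case ef: (Sf w x t) => [//|u].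
  case eg: (Sg w x t) => [//|v] /= <-.
  by rewrite (mf _ _ _ _ _ tt' ef) (mg _ _ _ _ _ tt' eg).
Qed.

Lemma simulates_comp f g Sf Sg : simulates f Sf -> simulates g Sg ->
  simulates (PComp f g) (fun w x t =>
    if Sg w x t == 0 then 0 else Sf w (Sg w x t).-1 t).
Proof.
move=> [rf sf cf mf] [rg sg cg mg]; split.
- by recursivity.
- move=> w x t y; case eg: (Sg w x t) => [//|u] /= ef.
  have [q Hq] := sf _ _ _ _ ef; have [r Hr] := sg _ _ _ _ eg.
  by exists (r ++ q); apply: runs_comp Hr Hq.
- move=> w x y q /runsE[u [q1 [q2 [/cg[t1 H1] /cf[t2 H2] _]]]].
  exists (maxn t1 t2); rewrite (mg _ _ _ _ _ (leq_maxl t1 t2) H1) /=.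
  exact: (mf _ _ _ _ _ (leq_maxr t1 t2) H2).
- move=> w x y t t' tt'; case eg: (Sg w x t) => [//|u] /= ef.
  by rewrite (mg _ _ _ _ _ tt' eg) /=; apply: mf ef.
Qed.

(** The clock [t] limits only the calls of [f] and [g]; the [csnd x] rounds are themselves a
    primitive recursion. *)
Lemma simulates_rec f g Sf Sg : simulates f Sf -> simulates g Sg ->
  simulates (PRec f g) (fun w x t =>
    iteri (csnd x) (fun j u => if u == 0 then 0
                             else Sg w (cpair (cfst x) (cpair j u.-1)) t)
      (Sf w (cfst x) t)).
Proof.
move=> [rf sf cf mf] [rg sg cg mg]; split.
- by recursivity.
- move=> w x t y; rewrite -(cpair_proj x) !cpairE.
  elim: (csnd x) y => [|n IH] y /=.
    by move/sf=> [q Hq]; exists q; constructor.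
  case: (iteri n _ _) IH => [//|u] IH /= /sg[r Hr].
  have [q Hq] := IH _ erefl.
  by exists (q ++ r); apply: runs_recS Hq Hr.
- move=> w x; rewrite -(cpair_proj x) !cpairE.
  elim: (csnd x) => [|n IH] y q /runsE; rewrite !cpairE /=; first exact: cf.
  move=> [u [q1 [q2 [/IH[t1 H1] /cg[t2 H2] _]]]].
  exists (maxn t1 t2); have := leq_maxl t1 t2; have := leq_maxr t1 t2.
  move: (maxn t1 t2) => t t2t t1t.
  suff -> : iteri n (fun j u => if u == 0 then 0 else
      Sg w (cpair (cfst x) (cpair j u.-1)) t) (Sf w (cfst x) t) = u.+1.
    exact: mg t2t H2.
  elim: n {IH H2} u H1 => [|n IH] u /=; first exact: mf.
  case: (iteri n _ (Sf w (cfst x) t1)) IH => [//|v] IH /=.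
  by rewrite (IH _ erefl) /=; apply: mg.
- move=> w x y t t' tt'; elim: (csnd x) y => [|n IH] y /=; first exact: mf.
  case: (iteri n _ (Sf w (cfst x) t)) IH => [//|v] IH /=.
  by rewrite (IH _ erefl) /=; apply: mg.
Qed.

(** The search stops at the first argument whose value is 0 ([S] is 1) or still unknown ([S] is 0).
    An unknown value must not be skipped: it may turn out to be 0 later, and the answer would change
    with the stage. *)
Definition min_sim (S : nat -> nat -> nat -> nat) (w x t : nat) : nat :=
  csnd x + find (fun j => S w (cpair (cfst x) (csnd x + j)) t <= 1) (iota 0 t).

Lemma simulates_min f Sf : simulates f Sf ->
  simulates (PMin f) (fun w x t =>
    if (min_sim Sf w x t < csnd x + t) &&
       (Sf w (cpair (cfst x) (min_sim Sf w x t)) t == 1)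
    then (min_sim Sf w x t).+1 else 0).
Proof.
move=> [rf sf cf mf].
set S := (fun w x t => _).
have SP w x t y : S w x t = y.+1 <->
    [/\ csnd x <= y < csnd x + t, Sf w (cpair (cfst x) y) t = 1
      & forall m, csnd x <= m < y -> exists u, Sf w (cpair (cfst x) m) t = u.+2].
  rewrite /S /min_sim; set P := (fun j => _ <= 1).
  split.
    case: ifP => // /andP[lt /eqP e1] [<-]; rewrite lt leq_addr; split=> // m.
    move=> /andP[nm]; rewrite -{1}(subnKC nm) ltn_add2l => mf'.
    have := before_find 0 mf'; rewrite nth_iota; last first.
      by apply: leq_trans mf' _; rewrite (leq_trans (find_size _ _)) ?size_iota.
    rewrite add0n /P subnKC // => /negbT; rewrite -ltnNge.
    by case: (Sf _ _ _) => [//|[//|u]] _; exists u.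
  case=> /andP[ny yt] e Hm.
  have -> : find P (iota 0 t) = y - csnd x.
    apply: find_iota.
    - by rewrite ltn_subLR.
    - by rewrite /P subnKC // e.
    - move=> j jy; rewrite /P; have [|u ->//] := Hm (csnd x + j).
      by rewrite leq_addr -ltn_subRL.
  by rewrite subnKC // yt e.
split.
- rewrite /S /min_sim; recursivity.
  + by apply: recursive_find; recursivity.
  + by apply: recursive_find; recursivity.
  + by apply: recursive_find; recursivity.
- move=> w x t y /SP[/andP[ny yt] e Hm].
  rewrite -(cpair_proj x); apply/runs_PMinP; split=> //.
    exact: sf e.
  by move=> m /Hm[u /sf]; exists u.
- move=> w x y q; rewrite -[x in runs _ _ x _ _]cpair_proj => H.
  have [|ny [q' /cf[t0 H0]] Hm] := (runs_PMinP (bits w) f (cfst x) (csnd x) y).1.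
    by exists q.
  have [t1 H1] : exists t, forall m, csnd x <= m < y ->
      exists u, Sf w (cpair (cfst x) m) t = u.+2.
    elim: (y) Hm => [_|k IH Hm]; first by exists 0 => m; rewrite ltn0 andbF.
    have [m /andP[xm mk]|t Ht] := IH; first by apply: Hm; rewrite xm ltnS ltnW.
    have [xk|kx] := leqP (csnd x) k; last first.
      by exists t => m /andP[xm mk]; lia.
    have [|u [r /cf[t' Ht']]] := Hm k; first by rewrite xk /=.
    exists (maxn t t') => m /andP[xm]; rewrite ltnS leq_eqVlt.
    case: eqP => [-> _|_ /= mk].
      by exists u; apply: mf Ht'; apply: leq_maxr.
    have [|v Hv] := Ht m; first by rewrite xm.
    by exists v; apply: mf Hv; apply: leq_maxl.
  exists (maxn y.+1 (maxn t0 t1)); apply/SP; split.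
  + by rewrite ny; lia.
  + by apply: mf H0; lia.
  + by move=> m /H1[u Hu]; exists u; apply: mf Hu; lia.
- move=> w x y t t' tt' /SP[/andP[ny yt] e Hm]; apply/SP; split.
  + by rewrite ny (leq_trans yt) // leq_add2l.
  + exact: mf e.
  + by move=> m /Hm[u Hu]; exists u; apply: mf Hu.
Qed.

(** Induction on the syntax gives each program its own stage function, in place of a universal
    machine. *)
Lemma simulation p : exists S, simulates p S.
Proof.
elim: p => [|||||f [Sf Hf] g [Sg Hg]|f [Sf Hf] g [Sg Hg]|f [Sf Hf] g [Sg Hg]|f [Sf Hf]].
- exists (fun w x _ => 1); apply: (@simulates_total _ (fun _ _ => 0)).
    by recursivity.
  by move=> w x; exists [::]; constructor.
- exists (fun w x _ => x.+2); apply: (@simulates_total _ (fun _ x => x.+1)).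
    by recursivity.
  by move=> w x; exists [::]; constructor.
- exists (fun w x _ => (cfst x).+1); apply: (@simulates_total _ (fun _ x => cfst x)).
    by recursivity.
  by move=> w x; exists [::]; rewrite -[x in runs _ _ x _ _]cpair_proj; constructor.
- exists (fun w x _ => (csnd x).+1); apply: (@simulates_total _ (fun _ x => csnd x)).
    by recursivity.
  by move=> w x; exists [::]; rewrite -[x in runs _ _ x _ _]cpair_proj; constructor.
- exists (fun w x _ => (nat_of_bool (bits w x)).+1).
  apply: (@simulates_total _ (fun w x => nat_of_bool (bits w x))).
    by rewrite /bits; recursivity.
  by move=> w x; exists [:: x]; constructor.
- by eexists; apply: simulates_pair Hf Hg.
- by eexists; apply: simulates_comp Hf Hg.
- by eexists; apply: simulates_rec Hf Hg.
- by eexists; apply: simulates_min Hf.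
Qed.

(** * Measure of sets of strings *)

Section Cylinders.
Import Order.TTheory GRing.Theory Num.Theory.
Local Open Scope classical_set_scope.
Local Open Scope ring_scope.
Variable R : realType.
Implicit Types (s t : seq bool) (x : R).

(** The map [2 * x - b] removes the first binary digit. This recursion replaces the explicit sum in
    the inductions on strings. *)
Lemma cylinder_cons b s x : cylinder (b :: s) x <-> cylinder s (2 * x - b%:R).
Proof.
rewrite /cylinder /= !in_itv /=.
have e2 : (2 : R) != 0 by rewrite pnatr_eq0.
set a := \sum_(k < size s) _; set l := (2 ^+ size s)^-1.
have -> : \sum_(k < (size s).+1) (nth false (b :: s) k)%:R / 2 ^+ k.+1 =
    (b%:R + a) / 2 :> R.
  rewrite big_ord_recl /= expr1 mulrDl; congr (_ + _).
  rewrite mulr_suml; apply: eq_bigr => i _.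
  by rewrite /= /bump /= add1n [in LHS]exprSr invfM mulrA.
have -> : (2 ^+ (size s).+1)^-1 = l / 2 :> R by rewrite exprSr invfM mulrC.
by split=> /andP[h1 h2]; apply/andP; split; lra.
Qed.

Lemma cylinder_bounds s x : cylinder s x -> 0 <= x < 1.
Proof.
elim: s x => [|b s IH] x.
  by rewrite /cylinder /= big_ord0 in_itv /= expr0 invr1 add0r.
by move/cylinder_cons/IH; case: b => /=; lra.
Qed.

Lemma cylinder_inj s t x :
  size s = size t -> cylinder s x -> cylinder t x -> s = t.
Proof.
elim: s t x => [|b s IH] [|c t] x //= [est] /cylinder_cons Hs /cylinder_cons Ht.
suff e : b = c by rewrite -e in Ht *; rewrite (IH t _ est Hs Ht).
by move: (cylinder_bounds Hs) (cylinder_bounds Ht); case: b c {Hs Ht} => [] [] //=; lra.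
Qed.

Lemma cylinder_cat s t : cylinder (s ++ t) `<=` (cylinder s : set R).
Proof.
elim: s => [|b s IH] x /=.
  move/cylinder_bounds.
  by rewrite /cylinder /= big_ord0 in_itv /= expr0 invr1 add0r.
by move/cylinder_cons/IH => H; apply/cylinder_cons.
Qed.

Lemma measurable_cylinder s :
  measurable (cylinder s : set (measurableTypeR R)).
Proof. exact: measurable_itv. Qed.

Lemma cylinder_measure s :
  lebesgue_measure (@cylinder R s) = ((2 ^+ size s)^-1)%:E.
Proof.
have l0 : (0 : R) < (2 ^+ size s)^-1 by rewrite invr_gt0 exprn_gt0.
by rewrite /cylinder lebesgue_measure_itv /= lte_fin ltrDl l0 -EFinD addrAC subrr add0r.
Qed.

Lemma measurable_bigcup_cylinder (A : set (seq bool)) :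
  measurable (\bigcup_(s in A) cylinder s : set (measurableTypeR R)).
Proof.
rewrite bigcup_mkcond; apply: countable_bigcupT_measurable => [|s].
  exact: countableP.
by case: ifP => _; [apply: measurable_cylinder|apply: measurable0].
Qed.

Lemma str_measure_le (A : set (seq bool)) n N (F : nat -> seq bool) :
  (forall s, A s -> size s = n /\ exists2 k, (k < N)%N & s = F k) ->
  (str_measure R A <= (N%:R / 2 ^+ n)%:E)%E.
Proof.
(* Entries of [F] of another length lie outside [A] and may have larger cylinders, so they are
   replaced by [set0]. *)
move=> HA; pose G k : set (measurableTypeR R) :=
  if size (F k) == n then cylinder (F k) else set0.
have mG k : measurable (G k).
  by rewrite /G; case: ifP => _; [apply: measurable_cylinder|apply: measurable0].
apply: (@le_trans _ _ (lebesgue_measure (\big[setU/set0]_(k < N) G k))).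
  apply: le_measure; rewrite ?inE.
  - exact: measurable_bigcup_cylinder.
  - exact: bigsetU_measurable.
  move=> x [s /HA[sn [k kN e]] sx]; rewrite -bigcup_mkord; exists k => //.
  by rewrite /G -e sn eqxx.
apply: (le_trans (Boole_inequality _ _)) => //.
have -> : (N%:R / 2 ^+ n)%:E = \sum_(k < N) ((2 ^+ n)^-1)%:E :> \bar R.
  by rewrite sumEFin sumr_const card_ord mulr_natl.
apply: lee_sum => k _; rewrite /G; case: eqP => [<-|_].
  by rewrite le_eqVlt; apply/orP; left; apply/eqP/cylinder_measure.
by rewrite measure0 lee_fin invr_ge0 exprn_ge0.
Qed.

(** Cylinders of distinct strings of equal length are disjoint, so their measures add up; each one
    marked by [P] lies inside the cylinder of a prefix from [A]. *)
Lemma str_measure_ge (A : set (seq bool)) n N (F : nat -> seq bool)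
    (P : pred nat) :
  (forall k, (k < N)%N -> size (F k) = n) ->
  (forall k l, (k < N)%N -> (l < N)%N -> F k = F l -> k = l) ->
  (forall k, (k < N)%N -> P k -> exists m, A (take m (F k))) ->
  (((count P (iota 0 N))%:R / 2 ^+ n)%:E <= str_measure R A)%E.
Proof.
move=> sF iF HA.
pose G (k : 'I_N) : set (measurableTypeR R) := cylinder (F k).
have mG k : measurable (G k) by apply: measurable_cylinder.
apply: (@le_trans _ _ (lebesgue_measure (\big[setU/set0]_(k < N | P k) G k))).
  rewrite measure_bigsetU_ord //; last first.
    move=> i j _ _ [x [xi xj]]; apply/val_inj/iF; try exact: ltn_ord.
    by apply: (@cylinder_inj _ _ x _ xi xj); rewrite !sF.
  rewrite (eq_bigr (fun=> ((2 ^+ n)^-1)%:E)); last first.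
    by move=> k _; rewrite -(sF k) //; apply: cylinder_measure.
  rewrite sumEFin lee_fin sumr_const -[leRHS]mulr_natl -sum1_count.
  by rewrite -[iota 0 N](congr1 (iota 0) (subn0 N)) big_mkord sum1_card.
apply: le_measure; rewrite ?inE.
- by apply: bigsetU_measurable.
- exact: measurable_bigcup_cylinder.
elim/big_ind: _ => [//|B C HB HC x [/HB|/HC]//|k Pk x xk].
have [m Am] := HA k (ltn_ord k) Pk; exists (take m (F k)) => //.
by apply: (@cylinder_cat _ (drop m (F k))); rewrite cat_take_drop.
Qed.
End Cylinders.

(** * Short use yields a test *)

Import Order.TTheory GRing.Theory Num.Theory.

(** * Numbers as finite binary strings *)

Definition natval (n : nat) (f : nat -> bool) : nat :=
  \sum_(0 <= j < n) f j * 2 ^ j.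

Lemma natvalS n f : natval n.+1 f = f 0 + (natval n (fun j => f j.+1)).*2.
Proof.
rewrite /natval big_nat_recl // expn0 muln1 -mul2n big_distrr /=; congr (_ + _).
by apply: eq_bigr => j _; rewrite expnS mulnCA.
Qed.

Lemma bits0 w : bits w 0 = odd w.
Proof. by rewrite /bits expn0 divn1. Qed.

Lemma bitsS w j : bits w j.+1 = bits w./2 j.
Proof. by rewrite /bits expnS divnMA divn2. Qed.

Lemma natval_lt n f : natval n f < 2 ^ n.
Proof.
elim: n f => [|n IH] f; first by rewrite /natval big_geq.
by rewrite natvalS expnS; have := IH (fun j => f j.+1); case: (f 0); lia.
Qed.

Lemma bits_natval n f j : j < n -> bits (natval n f) j = f j.
Proof.
elim: n f j => // n IH f [|j] jn; rewrite natvalS.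
  by rewrite bits0 oddD odd_double addbF oddb.
by rewrite bitsS half_bit_double IH.
Qed.

Lemma natval_bits n w : w < 2 ^ n -> natval n (bits w) = w.
Proof.
elim: n w => [|n IH] w wn.
  by rewrite /natval big_geq //; case: w wn.
rewrite natvalS bits0 -[RHS]odd_double_half; congr (_ + _.*2).
rewrite -[RHS]IH; first by apply: eq_bigr => j _; rewrite bitsS.
by rewrite expnS in wn; have := odd_double_half w; lia.
Qed.

Lemma eq_natval n f g : (forall j, j < n -> f j = g j) -> natval n f = natval n g.
Proof. by move=> fg; apply: eq_big_nat => j /andP[_ /fg->]. Qed.

Lemma str_code_inj : injective str_code.
Proof.
elim=> [|b s IH] [|c t] //= []; rewrite -!/(str_code _) => e.
suff bc : b = c by rewrite -bc in e *; congr cons; apply: IH; lia.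
have := congr1 odd e; rewrite !oddD !odd_double !addbF.
by case: b c {e} => [] [].
Qed.

Lemma str_code_mkseq f n :
  str_code (mkseq f n) = \sum_(0 <= j < n) (nat_of_bool (f j)).+1 * 2 ^ j.
Proof.
elim: n f => [|n IH] f; first by rewrite big_geq.
rewrite big_nat_recl // expn0 muln1.
have -> : mkseq f n.+1 = f 0 :: mkseq (fun j => f j.+1) n.
  by rewrite /mkseq /= -[1]/(1 + 0) iotaDl -map_comp.
rewrite /= -/(str_code _) IH -mul2n big_distrr /= addSn; congr (_ + _).+1.
by apply: eq_bigr => j _; rewrite expnS mulnCA.
Qed.

Lemma uniform_stage (n : nat) (P : nat -> nat -> Prop) :
  (forall j t t', t <= t' -> P j t -> P j t') ->
  (forall j, j < n -> exists t, P j t) -> exists t, forall j, j < n -> P j t.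
Proof.
move=> mono; elim: n => [|n IH] H; first by exists 0.
have [j /ltnW/H//|t Ht] := IH; have [//|t' Ht'] := H n.
exists (maxn t t') => j; rewrite ltnS leq_eqVlt => /predU1P[->|jn].
  by apply: mono Ht'; apply: leq_maxr.
by apply: mono (Ht _ jn); apply: leq_maxl.
Qed.

Lemma recursive_semidecision (T : nat -> nat -> bool) :
  recursive2 (fun a m => nat_of_bool (T a m)) ->
  exists p, forall Z a, (exists y q, runs Z p a y q) <-> exists m, T a m.
Proof.
move=> /recursive_search[p _ Hp]; exists p => Z a; split.
  by case=> y [q /Hp[_ Ty _]]; exists y.
move=> ex; exists (ex_minn ex), [::]; apply/Hp; case: ex_minnP => m Tm Hm.
by split=> // k; rewrite ltnNge; apply: contra => /Hm.
Qed.

Section ComputedStrings.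
Variables (Phi : prog) (u n : nat -> nat).
Hypotheses (recu : recursive u) (recn : recursive n).

(** Queries past the digits of [w] are answered by 0, so [w] alone determines the string and the
    number of oracles [w] bounds the number of strings. *)
Definition computed_strings (i : nat) : set (seq bool) :=
  fun s => size s = n i /\ exists2 w, w < 2 ^ u i &
    forall j, j < n i -> exists q, runs (bits w) Phi j (nth false s j) q.

Lemma computed_strings_ce : uniformly_ce computed_strings.
Proof.
have [S [rS sS cS mS]] := simulation Phi.
(* A witness [m] pairs an oracle with a stage. A halted simulation returns the output bit plus one,
   which is exactly a digit 1 or 2 of bijective base 2, so the last sum is the code of the computed
   string. *)
pose T a m := [&& (cfst m).+1 <= 2 ^ u (cfst a),
  all (fun j => (1 <= S (cfst m) j (csnd m)) && (S (cfst m) j (csnd m) <= 2))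
    (iota 0 (n (cfst a)))
  & csnd a == \sum_(0 <= j < n (cfst a)) S (cfst m) j (csnd m) * 2 ^ j].
have [|p Hp] := @recursive_semidecision T; first by rewrite /T; recursivity.
exists p => i s; rewrite Hp /T !cpairE; split.
  case=> sn [w wu Hw].
  have [||t Ht] := @uniform_stage (n i) (fun j t => S w j t = (nth false s j).+1).
  - by move=> j t t'; apply: mS.
  - by move=> j /Hw[q /cS].
  exists (cpair w t); rewrite !cpairE wu /=; apply/andP; split.
    apply/allP => j; rewrite mem_iota add0n /= => /Ht ->.
    by case: (nth _ _ _).
  rewrite -[s in str_code s](mkseq_nth false) str_code_mkseq sn; apply/eqP.
  by apply: eq_big_nat => j /andP[_ /Ht ->].
case=> m /and3P[wu /allP Hm /eqP e].
have Sj j : j < n i -> S (cfst m) j (csnd m) = (nat_of_bool (S (cfst m) j (csnd m) == 2)).+1.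
  move=> jn; have : j \in iota 0 (n i) by rewrite mem_iota.
  by move/Hm; case: (S _ _ _) => [|[|[]]].
have -> : s = mkseq (fun j => S (cfst m) j (csnd m) == 2) (n i).
  apply: str_code_inj; rewrite e str_code_mkseq.
  by apply: eq_big_nat => j /andP[_ /Sj {1}->].
split; first by rewrite size_mkseq.
exists (cfst m) => // j jn; rewrite nth_mkseq //; apply: (sS _ _ (csnd m)).
exact: Sj.
Qed.

Lemma computed_strings_test (R : realType) :
  (forall i, u i + i <= n i) -> martin_lof_test R computed_strings.
Proof.
move=> ui; split=> [|i]; first exact: computed_strings_ce.
(* At most one string qualifies, by determinism; the default [[::]] serves the [w] that compute no
   string of this length. *)
pose F w := xget [::] (fun s => size s = n i /\
   forall j, j < n i -> exists q, runs (bits w) Phi j (nth false s j) q).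
have HF s : computed_strings i s ->
    size s = n i /\ exists2 w, w < 2 ^ u i & s = F w.
  case=> sn [w wu Hw]; split=> //; exists w => //.
  rewrite /F; case: xgetP => [t _ [tn Ht]|/(_ s)[]//].
  apply: (@eq_from_nth _ false) => [|j]; rewrite sn // => jn.
  have [q Hq] := Hw j jn; have [r Hr] := Ht j jn.
  have [] := runs_det Hq Hr.
  by case: (nth false s j); case: (nth false t j).
apply: (le_trans (str_measure_le R HF)).
rewrite lee_fin natrX -(subnKC (ui i)) -addnA exprD invfM mulrA.
rewrite divff ?expf_neq0 ?pnatr_eq0 // mul1r exprD invfM.
rewrite ger_pMr ?invr_gt0 ?exprn_gt0 //.
by rewrite invf_le1 ?exprn_gt0 // exprn_ege1 // ler1n.
Qed.
End ComputedStrings.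

Lemma recursive_use h : recursive h -> recursive (use h).
Proof.
move=> rh; have : recursive (fun n => (\max_(0 <= i < n) h i).+1) by recursivity.
by apply: recursive_ext => n; rewrite big_mkord.
Qed.

Lemma random_use_bound (R : realType) (X Y : nat -> bool) Phi h :
  granularly_random R X -> wtt_reduction Phi h -> maps_to Phi Y X ->
  exists c : nat, forall n : nat, n - c <= use h n.
Proof.
move=> rnd [/computable_recursive rh wtt] XY.
apply: contrapT => /forallNP nc; apply: rnd.
have ru := recursive_use rh.
have [||n rn Hn] := @recursive_ex_min (fun i n => use h n + i <= n).
- by recursivity.
- move=> i; have /existsNP[n /negP] := nc i; rewrite -ltnNge => lt.
  by exists n; lia.
pose u i := use h (n i); have ru' : recursive u by rewrite /u; recursivity.
exists (computed_strings Phi u n); split.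
- by apply: computed_strings_test => // i; case: (Hn i).
(* These partial sums dominate [n i] and increase strictly by construction, thanks to the successor
   in each term. *)
- exists (fun i => \sum_(0 <= j < i.+1) (n j).+1); split.
  + by apply: recursive_computable; recursivity.
  + apply: homo_ltn => [|i]; first exact: ltn_trans.
    by rewrite [ltnRHS]big_nat_recr //= addnS ltnS leq_addr.
  + by move=> i s [-> _]; rewrite big_nat_recr //=; lia.
- move=> i; exists (n i); split; first by rewrite size_mkseq.
  exists (natval (u i) Y) => [|j jn]; first exact: natval_lt.
  have [q Hq] := XY j; exists q; rewrite nth_mkseq //.
  (* A query for [j < n i] is at most [h j]; the successor in [use] turns the largest such position
     into a length, so the query falls below [u i]. *)
  apply: (runs_agree Hq) => k kq; rewrite bits_natval //.
  rewrite ltnS (leq_trans (wtt _ _ _ _ Hq k kq)) //.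
  exact: (@leq_bigmax _ (fun i : 'I__ => h i) (Ordinal jn)).
Qed.

(** * A test yields short use *)

(** All queries of the decoder are made here. The window depends on [x] and not on the oracle, which
    keeps the reduction weak truth-table. *)
Lemma oracle_block (o w : nat -> nat) : recursive o -> recursive w ->
  exists p, forall Z x, exists2 q,
    runs Z p x (natval (w x) (fun r => Z (o x + r))) q &
    forall k, k \in q -> o x <= k < o x + w x.
Proof.
move=> ro rw.
have [pz _ Hz] : recursive (fun x => 0) by recursivity.
(* On [cpair (cpair a (cpair r u)) b], with [u] the value so far and [b] the bit read at place [r],
   the result is [u + b * 2 ^ r]. *)
have [pa _ Ha] : recursive (fun z => csnd (csnd (cfst z)) + csnd z * 2 ^ cfst (csnd (cfst z))).
  by recursivity.
have [pq _ Hq] : recursive (fun z => o (cfst z) + cfst (csnd z)) by recursivity.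
have [pw _ Hw] : recursive (fun x => cpair x (w x)) by recursivity.
have [pid _ Hid] := recursive_id.
pose step := PComp pa (PPair pid (PComp POracle pq)).
exists (PComp (PRec pz step) pw) => Z x.
have Hstep a r u :
    runs Z step (cpair a (cpair r u)) (u + Z (o a + r) * 2 ^ r) [:: o a + r].
  set z := cpair a _.
  have := Ha Z (cpair z (Z (o a + r))); rewrite !cpairE => Haz.
  have := Hq Z z; rewrite !cpairE => Hqz.
  apply: (runs_comp (q := [:: o a + r]) (r := [::])) Haz.
  apply: (runs_pair (q := [::])); first exact: Hid.
  by apply: (runs_comp (q := [::])) Hqz _; constructor.
suff [q H1 H2] : exists2 q, runs Z (PRec pz step) (cpair x (w x))
    (natval (w x) (fun r => Z (o x + r))) q &
    forall k, k \in q -> o x <= k < o x + w x.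
  by exists q => //; apply: (runs_comp (q := [::])) (Hw Z x) H1.
elim: (w x) => [|m [q IH Hk]].
  by exists [::] => //; rewrite /natval big_geq //; constructor; apply: Hz.
exists (q ++ [:: o x + m]) => [|k].
  by rewrite /natval big_nat_recr //=; apply: runs_recS IH _; apply: Hstep.
rewrite mem_cat inE => /orP[/Hk|/eqP->]; lia.
Qed.

(** * Short codes from ranks in an enumeration *)

Section Decoding.
Variables (R : realType) (V : nat -> set (seq bool)) (g : nat -> nat).
Hypotheses (testV : martin_lof_test R V) (rec_g : recursive g).
Hypotheses (g_mono : {homo g : i j / i < j}).
Hypotheses (g_bound : forall i s, V i s -> size s <= g i).

Lemma g_ge i : i <= g i.
Proof.
by elim: i => // i IH; apply: leq_ltn_trans IH _; apply: g_mono.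
Qed.

(** [found i v u] means that by stage [u] some prefix of the string of length [g i] with digits [v]
    is seen to be in [V i]. Granularity enters here: only the finitely many prefixes of length at
    most [g i] have to be watched. *)
Lemma stages : exists found : nat -> nat -> nat -> bool,
  [/\ recursive3 (fun i v u => nat_of_bool (found i v u)),
      forall i v u u', u <= u' -> found i v u -> found i v u',
      forall i v u, found i v u -> exists l, V i (take l (mkseq (bits v) (g i)))
    & forall i v l, V i (mkseq (bits v) l) -> exists u, found i v u].
Proof.
have [[p Hp] _] := testV.
have [S [rS sS cS mS]] := simulation p.
pose code v l := \sum_(0 <= j < l) (nat_of_bool (bits v j)).+1 * 2 ^ j.
(* The enumeration of [V] runs on [no_oracle], which among the finite oracles is the number 0. *)
have Z0 : bits 0 = no_oracle by apply/funext => j; rewrite /bits div0n.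
exists (fun i v u => ~~ all (fun l => S 0 (cpair i (code v l)) u == 0)
  (iota 0 (g i).+1)); split.
- by rewrite /code /bits; recursivity.
- move=> i v u u' uu'; apply: contra => /allP H; apply/allP => l /H.
  case E : (S 0 _ u) => [//|y].
  by rewrite (mS _ _ _ _ _ uu' E).
- move=> i v u /allPn[l]; rewrite mem_iota add0n /= ltnS => lg Sl.
  exists l; have -> : take l (mkseq (bits v) (g i)) = mkseq (bits v) l.
    by rewrite /mkseq -map_take take_iota (minn_idPl lg).
  apply/Hp; rewrite str_code_mkseq -/(code v l) -Z0.
  case E : (S 0 (cpair i (code v l)) u) Sl => [//|y] _.
  by exists y; apply: sS E.
- move=> i v l Vl; have := g_bound Vl; rewrite size_mkseq => lg.
  have /Hp[y [q]] := Vl; rewrite str_code_mkseq -/(code v l) -Z0 => /cS[u Hu].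
  exists u; apply/allPn; exists l; first by rewrite mem_iota.
  by rewrite Hu.
Qed.

(* A string of length [g i] with a prefix in [V i] is determined by the position
   at which it shows up in an enumeration of all such strings; as these have
   measure at most [2 ^ - i], there are at most [2 ^ (g i - i)] positions. *)
Lemma decoding : exists dec : nat -> nat -> nat -> bool,
  [/\ recursive3 (fun i e t => nat_of_bool (dec i e t)),
      forall i e t t', dec i e t -> dec i e t' -> t = t'
    & forall i X, (exists n, V i (restr X n)) -> exists e t,
        [/\ e < 2 ^ (g i - i), dec i e t & forall j, j < g i -> bits (cfst t) j = X j]].
Proof.
have [found [rf mf sf cf]] := stages.
(* Here [t] pairs a string with the very first stage at which it is found, so no string is counted
   twice and the rank of a fresh [t] determines [t]. *)
pose fresh i t := [&& (cfst t).+1 <= 2 ^ g i, found i (cfst t) (csnd t)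
  & all (fun u => ~~ found i (cfst t) u) (iota 0 (csnd t))].
have rfresh : recursive2 (fun i t => nat_of_bool (fresh i t)).
  by rewrite /fresh; recursivity.
pose rank i t := \sum_(0 <= t' < t) nat_of_bool (fresh i t').
have rrank : recursive2 rank by rewrite /rank; recursivity.
exists (fun i e t => fresh i t && (rank i t == e)); split.
- by recursivity.
- move=> i e; suff lt t t' : fresh i t -> t < t' -> rank i t < rank i t'.
    move=> t t' /andP[ft /eqP rt] /andP[ft' /eqP rt'].
    case: (ltngtP t t') => // [/(lt _ _ ft)|/(lt _ _ ft')].
      by rewrite rt rt' ltnn.
    by rewrite rt rt' ltnn.
  move=> ft tt'; rewrite /rank [ltnRHS](big_cat_nat (n := t.+1)) //=.
  by rewrite big_nat_recr //= ft addn1 addSn ltnS leq_addr.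
move=> i X [l VX].
have lg : l <= g i by have := g_bound VX; rewrite size_mkseq.
pose v := natval (g i) X.
have Xv j : j < g i -> bits v j = X j by apply: bits_natval.
have [|u0 Hu0] := cf i v l.
  have -> // : mkseq (bits v) l = restr X l.
  apply: (@eq_from_nth _ false); rewrite !size_mkseq // => j jl.
  by rewrite !nth_mkseq // Xv // (leq_trans jl).
have exu : exists u, found i v u by exists u0.
case: (ex_minnP exu) => u Hu umin {u0 Hu0 exu}.
pose t := cpair v u.
have ft : fresh i t.
  rewrite /fresh !cpairE natval_lt Hu /=; apply/allP => u'.
  by rewrite mem_iota add0n /= ltnNge; apply: contra => /umin.
exists (rank i t), t; split; first last.
- by move=> j; rewrite cpairE; apply: Xv.
- by rewrite ft /=.
pose P v := `[< exists u, found i v u >].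
(* The fresh pairs before [t] and [t] itself have distinct first components, all of which satisfy
   [P]. *)
have szc : (rank i t).+1 <= count P (iota 0 (2 ^ g i)).
  have -> : (rank i t).+1 = size [seq cfst t' | t' <- [seq t' <- iota 0 t.+1 | fresh i t']].
    rewrite size_map size_filter -sum1_count -[iota 0 t.+1]/(index_iota 0 t.+1).
    by rewrite big_mkcond big_nat_recr //= ft addn1.
  rewrite -size_filter; apply: uniq_leq_size.
    rewrite map_inj_in_uniq ?filter_uniq ?iota_uniq // => a b.
    rewrite !mem_filter => /andP[/and3P[_ fa /allP ua] _] /andP[/and3P[_ fb /allP ub] _] e.
    rewrite -(cpair_proj a) -(cpair_proj b) e; congr cpair.
    case: (ltngtP (csnd a) (csnd b)) => // lt.
      by have := ub (csnd a); rewrite mem_iota add0n lt -e fa => /(_ isT).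
    by have := ua (csnd b); rewrite mem_iota add0n lt e fb => /(_ isT).
  move=> _ /mapP[a +] ->; rewrite mem_filter => /andP[/and3P[lt fa _] _].
  rewrite mem_filter mem_iota add0n /= lt andbT.
  by apply/asboolP; exists (csnd a).
have cnt : count P (iota 0 (2 ^ g i)) * 2 ^ i <= 2 ^ g i.
  have [_ /(_ i) muV] := testV.
  have := le_trans (@str_measure_ge R (V i) (g i) (2 ^ g i)
    (fun v => mkseq (bits v) (g i)) P _ _ _) muV.
  rewrite lee_fin ler_pdivrMr ?exprn_gt0 // mulrC ler_pdivlMr ?exprn_gt0 //.
  rewrite -!natrX -natrM ler_nat; apply.
  - by move=> k _; rewrite size_mkseq.
  - move=> a b /natval_bits {2}<- /natval_bits {2}<- e.
    by apply: eq_natval => j jg; have := congr1 (nth false ^~ j) e; rewrite !nth_mkseq.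
  - by move=> a _ /asboolP[s /sf].
rewrite -(leq_pmul2r (expn_gt0 2 i)) -expnD subnK ?g_ge //.
by apply: leq_trans cnt; rewrite leq_mul2r szc orbT.
Qed.
End Decoding.

(** On input [m], [Phi] reads the block as a number, searches for the [t] that it codes and outputs
    bit [m] of [cfst t]. The bound on queries concerns all oracles, the value only those whose block
    is a code. The search returns the least [t], which is the intended one because a code determines
    its [t]. *)
Lemma block_decoder (o w lev : nat -> nat) (dec : nat -> nat -> nat -> bool) :
  recursive o -> recursive w -> recursive lev ->
  recursive3 (fun i e t => nat_of_bool (dec i e t)) ->
  (forall i e t t', dec i e t -> dec i e t' -> t = t') ->
  exists Phi,
    (forall Z m y q, runs Z Phi m y q -> forall k, k \in q -> k <= o m + w m) /\
    (forall Z m t, dec (lev m) (natval (w m) (fun r => Z (o m + r))) t ->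
       exists q, runs Z Phi m (bits (cfst t) m) q).
Proof.
move=> ro rw rl rdec dec_inj.
have [pe Hpe] := oracle_block ro rw.
have [|ps fps Hps] :=
  @recursive_search (fun a t => dec (lev (cfst a)) (csnd a) t); first by recursivity.
have [po fpo Hpo] : recursive (fun z => nat_of_bool (bits (cfst (csnd z)) (cfst z))).
  by rewrite /bits; recursivity.
have [pid fpid Hid] := recursive_id.
exists (PComp po (PPair pid (PComp ps (PPair pid pe)))); split.
  move=> Z m y q /runsE[z [q1 [q2 [/runsE[a [t [q3 [q4 [H3 H4 _ ->]]]]] H2 ->]]]].
  have -> := oracle_free_queries fpo H2; have -> := oracle_free_queries fpid H3.
  move: H4 => /runsE[b [q5 [q6 [/runsE[c [e [q7 [q8 [H7 H8 _ ->]]]]] H6 ->]]]].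
  have -> := oracle_free_queries fps H6; have -> := oracle_free_queries fpid H7.
  have [q' He Hq] := Hpe Z m; have [_ ->] := runs_det H8 He.
  by move=> k; rewrite /= !cats0 => /Hq /andP[_ /ltnW].
move=> Z m t; set e := natval _ _ => Ht.
have [q He _] := Hpe Z m.
have Hs : runs Z ps (cpair m e) t [::].
  apply/Hps; rewrite !cpairE; split=> // t' t't.
  by apply/negP => /(dec_inj _ _ _ _ Ht) e'; rewrite e' ltnn in t't.
exists (([::] ++ ([::] ++ q) ++ [::]) ++ [::]).
have := Hpo Z (cpair m t); rewrite !cpairE => Ho.
have Hes := runs_comp (runs_pair (Hid Z m) He) Hs.
exact: (runs_comp (runs_pair (Hid Z m) Hes) Ho).
Qed.

(** * The oracle made of blocks *)

Section Encoding.
Variables (X : nat -> bool) (g : nat -> nat) (dec : nat -> nat -> nat -> bool).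
Hypotheses (rec_g : recursive g) (g_ge : forall i, i <= g i).
Hypothesis rec_dec : recursive3 (fun i e t => nat_of_bool (dec i e t)).
Hypothesis dec_inj : forall i e t t', dec i e t -> dec i e t' -> t = t'.
Hypothesis dec_X : forall i, exists e t,
  [/\ e < 2 ^ (g i - i), dec i e t & forall j, j < g i -> bits (cfst t) j = X j].

(* Block [k] of the oracle starts at [offset k] and encodes the first
   [g (level k)] bits of [X]; the level is so high that the bits saved in this
   block outnumber by [k] the positions occupied by the previous blocks. *)
Fixpoint offset (k : nat) : nat :=
  if k is j.+1 then offset j + g (offset j + j) else 0.

Definition level (k : nat) : nat := offset k + k.

(** The digits of a code at level [level k]. Block [k] reserves [g (level k)] positions; the last
    [level k] of them will be [false] in the oracle. *)
Definition width (k : nat) : nat := g (level k) - level k.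

Lemma recursive_offset : recursive offset.
Proof.
have : recursive (fun k => iteri k (fun j u => u + g (u + j)) 0) by recursivity.
by apply: recursive_ext; elim=> //= k ->.
Qed.

Lemma offset_le k l : k <= l -> offset k <= offset l.
Proof.
elim: l => [|l IH]; first by case: k.
rewrite leq_eqVlt => /predU1P[->//|/IH kl].
by apply: leq_trans kl _; rewrite /= leq_addr.
Qed.

(** The summand [offset k] of [level k] cancels the start of the block, so the block ends [k]
    positions short of the number of bits that it encodes. *)
Lemma offset_width k : offset k + width k = g (level k) - k.
Proof.
rewrite /width; have := g_ge (level k); rewrite [X in X <= _]/level.
by rewrite {3}/level; lia.
Qed.

Lemma offset_width_le k l : k < l -> offset k + width k <= offset l.
Proof.
by move/offset_le; apply: leq_trans; rewrite /= leq_add2l leq_subr.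
Qed.

Lemma short_use_encoding : exists Y Phi h,
  [/\ wtt_reduction Phi h, maps_to Phi Y X
    & forall c, exists n, use h n < n - c].
Proof.
have rec_o := recursive_offset.
have rec_l : recursive level by rewrite /level; recursivity.
have rec_w : recursive width by rewrite /width; recursivity.
(* Bit [m] is decoded from the least block that covers it, so that no bit below [g (level k)] makes
   use of a block after block [k]. *)
have [||km rkm Hkm] := @recursive_ex_min (fun m k => m.+1 <= g (level k)).
- by recursivity.
- by move=> m; exists m.+1; apply: leq_trans (g_ge _); rewrite /level leq_addl.
have [e /choice[t Het]] := choice dec_X.
(* Only the decoding has to be effective, so the codes stored in [Y] may come from [choice]. *)
pose Y x := `[< exists k r, [/\ r < width k, x = offset k + r & bits (e (level k)) r] >].
have YE k r : r < width k -> Y (offset k + r) = bits (e (level k)) r.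
  move=> rk; apply/asboolP/idP => [[k' [r' [rk' eq]]]|]; last by exists k, r.
  case: (ltngtP k k') => [/offset_width_le|/offset_width_le|ek]; [lia|lia|].
  by rewrite -ek in eq *; rewrite (addnI eq).
have [Phi [usePhi runPhi]] := @block_decoder (fun m => offset (km m))
  (fun m => width (km m)) (fun m => level (km m)) dec
  (recursive_comp rec_o rkm) (recursive_comp rec_w rkm)
  (recursive_comp rec_l rkm) rec_dec dec_inj.
exists Y, Phi, (fun m => offset (km m) + width (km m)); split.
- split; last exact: usePhi.
  by apply: recursive_computable; recursivity.
- move=> m; have [lt dt Xt] := Het (level (km m)).
  rewrite -Xt; last by case: (Hkm m).
  apply: runPhi; rewrite (eq_natval (g := bits (e (level (km m))))).
    by rewrite natval_bits.
  by move=> r /YE.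
(* Of the two units added to [c], one pays for the successor in [use] and one for the strict
   inequality. *)
move=> c; exists (g (level c.+2)).
have le_h m : m < g (level c.+2) ->
    offset (km m) + width (km m) <= offset c.+2 + width c.+2.
  move=> mg; have [_ Hm] := Hkm m.
  have : km m <= c.+2 by rewrite leqNgt; apply/negP => /Hm; rewrite mg.
  rewrite leq_eqVlt => /predU1P[->//|/offset_width_le].
  by move/leq_trans; apply; apply: leq_addr.
have le_max : use (fun m => offset (km m) + width (km m)) (g (level c.+2)) <=
    (offset c.+2 + width c.+2).+1.
  by rewrite ltnS; apply/bigmax_leqP => i _; apply: le_h.
apply: leq_ltn_trans le_max _; rewrite offset_width.
have := g_ge (level c.+2); rewrite {1}/level; lia.
Qed.
End Encoding.

Theorem theorem1p7 (R : realType) (X : nat -> bool) :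
  granularly_random R X <->
  (forall (Y : nat -> bool) (Phi : prog) (h : nat -> nat),
     wtt_reduction Phi h -> maps_to Phi Y X ->
     exists c : nat, forall n : nat, n - c <= use h n).
Proof.
split=> [rnd Y Phi h|bound [V [testV [g [/computable_recursive rec_g g_mono g_bound]] VX]]].
  exact: random_use_bound rnd.
have [dec [rdec dec_inj dec_X]] := decoding testV rec_g g_mono g_bound.
have [Y [Phi [h [wtt XY short]]]] := short_use_encoding rec_g
  (g_ge g_mono) rdec dec_inj (fun i => dec_X i X (VX i)).
have [c Hc] := bound Y Phi h wtt XY.
by have [n] := short c; rewrite ltnNge Hc.
Qed.
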